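(* Let $p$ be a prime and let $G$ be a non-abelian $p$-group of order $p^n$ with $|G'|=p^k$ and $d(G)=d$. If $|\mathcal{M}(G)|=p^{\frac{1}{2}(d-1)(n+k-2)+1}$, then $G$ is capable.
   Context: $G'$ is the derived subgroup of $G$, $d(G)$ the minimum number of generators of $G$, and $\mathcal{M}(G)$ the Schur multiplier of $G$. A group $G$ is called capable if $G\cong H/Z(H)$ for some group $H$. *)

(* Defs.v *)
From HB Require Import structures.
From mathcomp Require Import all_boot all_order all_algebra.
From mathcomp Require Import all_fingroup all_solvable.
From mathcomp Require Import boolp classical_sets functions cardinality.
From mathcomp Require Import reals exp complex.

Set Implicit Arguments.
Unset Strict Implicit.
Unset Printing Implicit Defensive.

Local Open Scope ring_scope.
Local Open Scope classical_set_scope.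

Section SchurMultiplier.

(* R[i], for R the real numbers, is the field of complex numbers. *)
Variables (R : realType) (gT : finGroupType) (G : {group gT}).

Implicit Types f g : gT -> gT -> R[i].

(* 2-cocycles of G with values in C^x = C \ {0}, for the trivial action.  Only
   the values on G x G are meaningful; the others are unconstrained. *)
Definition cocycle2 f : Prop :=
  {in G &, forall x y, f x y != 0} /\
  {in G & &, forall x y z, f y z * f x (y * z)%g = f (x * y)%g z * f x y}.

(* f and g differ on G x G by the coboundary of a map u : G -> C^x; this makes
   cochains that agree on G x G cohomologous, whatever their other values. *)
Definition cohomologous f g : Prop :=
  exists u : gT -> R[i], {in G, forall x, u x != 0} /\
    {in G &, forall x y, g x y = f x y * (u x * u y / u (x * y)%g)}.

Definition cohomology_class f : set (gT -> gT -> R[i]) :=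
  [set g | cocycle2 g /\ cohomologous f g].

(* M(G) = H^2(G, C^x), as the set of cosets of B^2(G, C^x) in Z^2(G, C^x). *)
Definition schur_multiplier : set (set (gT -> gT -> R[i])) :=
  [set cohomology_class f | f in cocycle2].

End SchurMultiplier.

Arguments schur_multiplier R {gT} G.

Section Capable.

(* groupType is the structure of all groups, finite or infinite. *)
Variable H : groupType.

Definition group_center : set H := [set z | forall h : H, commute z h].

Definition center_cosets : set (set H) :=
  [set [set (h * z)%g | z in group_center] | h in setT].

Definition mul_set (A B : set H) : set H :=
  [set (a * b)%g | a in A & b in B].

End Capable.

Arguments group_center : clear implicits.
Arguments center_cosets : clear implicits.

(* G is isomorphic to H / Z(H), whose elements are the cosets of Z(H),
   multiplied as subsets of H. *)
Definition capable (gT : finGroupType) (G : {group gT}) : Prop :=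
  exists (H : groupType) (psi : gT -> set H),
    set_bij [set x | x \in G] (center_cosets H) psi /\
    {in G &, forall x y, psi (x * y)%g = mul_set (psi x) (psi y)}.

(* Main.v *)
(* For a cocycle f and commuting x, y put beta_f(x, y) = f(x, y) / f(y, x).  Let
   E be the extension of G by the product of one copy of C^x for each 2-cocycle f,
   twisted by f on that factor.  The centre of E lies over the subgroup of those
   z in Z(G) with beta_f(z, .) = 1 for all f.  If it is trivial, then G is
   isomorphic to E / Z(E).  Otherwise it contains some z of order p; then every
   cocycle on G is cohomologous to one inflated from G / <z>, so |M(G)| is at most
   |M(G / <z>)|, and this is too small by the bounds
     |M(A)|^2 <= |A|^(d - 1)                    for A abelian, d = d(A), and
     |M(H)|^2 <= p^((d - 1)(n + k - 2) + 2)     for H non-abelian, d = d(H),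
                                                |H| = p^n, |H'| = p^k.
   The first holds because the class of f is determined by the values of beta_f on
   pairs of elements of a basis.  The second is by induction on n, dividing by a
   central z of order p in H': one loses a factor p, from a cocycle of H / <z>
   which dies in H, and gains at most p^d, the number of possible beta_f(z, .).  If
   |H'| = p, this number is at most p^2: for z = [x, y], the character beta_f(z, .)
   is determined by its values at x and y. *)

Require Import Defs.
From HB Require Import structures.
From mathcomp Require Import all_boot all_order all_algebra.
From mathcomp Require Import all_fingroup all_solvable.
From mathcomp Require Import boolp classical_sets functions cardinality.
From mathcomp Require Import reals exp complex.
From mathcomp Require Import separable cyclotomic ring zify.

Set Implicit Arguments.
Unset Strict Implicit.
Unset Printing Implicit Defensive.

Import Order.TTheory GRing.Theory Num.Theory.

Local Open Scope ring_scope.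

(** * Roots of unity and counting families by their values *)

Lemma closed_prim_root_exists (F : numClosedFieldType) n :
  (0 < n)%N -> exists z : F, n.-primitive_root z.
Proof.
pose p : {poly F} := 'X^n - 1; have [r Dp] := closed_field_poly_normal p.
move=> n_gt0; rewrite (monicP _) ?monicXnsubC // scale1r in Dp.
have rn1 : all n.-unity_root r by apply/allP=> z; rewrite -root_prod_XsubC -Dp.
have sz_r : (n < (size r).+1)%N.
  by rewrite -(size_prod_XsubC r id) -Dp size_XnsubC.
have uniq_r : uniq r.
  by rewrite -separable_prod_XsubC -Dp separable_Xn_sub_1 // pnatr_eq0 -lt0n.
by have /hasP[z _ prim_z] := has_prim_root n_gt0 rn1 uniq_r sz_r; exists z.
Qed.

Lemma closed_root_exists (F : closedFieldType) n (a : F) :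
  (0 < n)%N -> exists c : F, c ^+ n = a.
Proof.
case: n => // n _.
have [c Dc] := @solve_monicpoly F n.+1 (fun i => if i is 0%N then a else 0) isT.
exists c; rewrite Dc big_ord_recl /= expr0 mulr1 big1 ?addr0 // => i _.
by rewrite mul0r.
Qed.

(** Induction on [s]: the family splits into at most [e x] parts by the value at the head [x], which
    is a power of one fixed primitive root of unity. *)
Lemma card_root_family (F : numClosedFieldType) (T : eqType) (e : T -> nat)
    (s : seq T) (I : finType) (v : I -> T -> F) (N : nat) (J : {set I}) :
  (forall x, x \in s -> (0 < e x)%N) ->
  (forall i x, i \in J -> x \in s -> v i x ^+ e x = 1) ->
  (forall K : {set I}, K \subset J ->
     {in K &, forall i j, {in s, v i =1 v j}} -> (#|K| <= N)%N) ->
  (#|J| <= (\prod_(x <- s) e x) * N)%N.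
Proof.
elim: s J => [|x s IHs] J e_gt0 v1 leN; first by rewrite big_nil mul1n leN.
have ex_gt0 := e_gt0 x (mem_head _ _).
have [z prim_z] := closed_prim_root_exists F ex_gt0.
pose Jk (k : 'I_(e x)) := [set i in J | v i x == z ^+ k].
have JkJ k : Jk k \subset J by apply/fintype.subsetP=> i; rewrite inE => /andP[].
have -> : J = (\bigcup_k Jk k)%SET.
  apply/setP=> i; apply/idP/bigcupP => [Ji|[k _]]; last by rewrite inE => /andP[].
  have [k Dk] := prim_rootP prim_z (v1 i x Ji (mem_head _ _)).
  by exists k; rewrite // inE Ji Dk eqxx.
rewrite big_cons -mulnA.
apply: (@leq_trans (\sum_(k < e x) #|Jk k|)).
  apply: (big_ind2 (fun (A : {set I}) n => #|A| <= n)%N) => //.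
    by rewrite cards0.
  move=> A a B b leA leB; apply: leq_trans (leq_add leA leB).
  by rewrite cardsU leq_subr.
rewrite -[X in (_ <= X * _)%N](card_ord (e x)) -sum_nat_const leq_sum // => k _.
apply: IHs => [y s_y|i y|K sKJk eqK].
- by rewrite e_gt0 // inE s_y orbT.
- by move=> /(fintype.subsetP (JkJ k)) Ji s_y; rewrite v1 // inE s_y orbT.
apply: leN (fintype.subset_trans sKJk (JkJ k)) _ => i j Ki Kj y; rewrite inE.
case/predU1P=> [->|]; last exact: eqK.
move/(fintype.subsetP sKJk): Ki; move/(fintype.subsetP sKJk): Kj.
by rewrite !inE => /andP[_ /eqP->] /andP[_ /eqP->].
Qed.

(** * Cocycles and the commutator pairing *)

Section MultiplicativeCharacter.

Variables (F : fieldType) (gT : finGroupType) (G : {group gT}) (chi : gT -> F).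
Hypothesis chi0 : {in G, forall x, chi x != 0}.
Hypothesis chiM : {in G &, forall x y, chi (x * y)%g = chi x * chi y}.

Lemma multiplicative1 : chi 1%g = 1.
Proof. by apply: (mulfI (chi0 (group1 G))); rewrite -chiM // mulg1 mulr1. Qed.

Lemma multiplicative_gen (B : {set gT}) :
  B \subset G -> {in B, forall x, chi x = 1} ->
  {in <<B>>%g, forall x, chi x = 1}.
Proof.
move=> /fintype.subsetP sBG chiB x; pose K := [set y in G | chi y == 1].
have gK : group_set K.
  apply/group_setP; split=> [|y t]; first by rewrite inE group1 multiplicative1 /=.
  move=> /setIdP[Gy /eqP chiy] /setIdP[Gt /eqP chit].
  by rewrite inE groupM //= chiM // chiy chit mulr1.
suffices /fintype.subsetP sBK : (<<B>> \subset Group gK)%g.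
  by move/sBK; rewrite inE => /andP[_ /eqP].
rewrite gen_subG; apply/fintype.subsetP=> y By.
by rewrite inE sBG //= chiB.
Qed.

Lemma multiplicative_commg : {in G &, forall x y, chi [~ x, y]%g = 1}.
Proof.
move=> x y Gx Gy; rewrite commgEl conjgE.
apply: (mulfI (mulf_neq0 (chi0 Gy) (chi0 Gx))).
rewrite mulr1 [RHS]mulrC -!chiM ?groupM ?groupV //; congr chi.
by rewrite !mulgA mulgK mulgV mul1g.
Qed.

Lemma multiplicative_der : {in G^`(1)%g, forall x, chi x = 1}.
Proof.
apply: multiplicative_gen => [|_ /imset2P[x y Gx Gy ->]].
  exact: fintype.subset_trans (subset_gen _) (der_sub 1 G).
exact: multiplicative_commg.
Qed.

End MultiplicativeCharacter.

Section Cocycles.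

Variables (R : realType) (gT : finGroupType) (G : {group gT}).
Implicit Types (f g : gT -> gT -> R[i]) (u : gT -> R[i]).

Definition coboundary u (x y : gT) : R[i] := u x * u y / u (x * y)%g.

Lemma cocycle2_coboundary u :
  {in G, forall x, u x != 0} -> cocycle2 G (coboundary u).
Proof.
move=> u0; split=> [x y Gx Gy|x y z Gx Gy Gz]; rewrite /coboundary.
  by rewrite !mulf_neq0 ?invr_eq0 ?u0 ?groupM.
have uxy := u0 _ (groupM Gx Gy); have uyz := u0 _ (groupM Gy Gz).
have uxyz := u0 _ (groupM Gx (groupM Gy Gz)); rewrite -mulgA.
by field; rewrite uxy uxyz uyz.
Qed.

Lemma cocycle2_mul f g : cocycle2 G f -> cocycle2 G g ->
  cocycle2 G (fun x y => f x y * g x y).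
Proof.
move=> [f0 fE] [g0 gE]; split=> [x y Gx Gy|x y z Gx Gy Gz].
  by rewrite mulf_neq0 ?f0 ?g0.
by rewrite mulrACA fE // gE // mulrACA.
Qed.

Lemma cocycle2_inv f : cocycle2 G f -> cocycle2 G (fun x y => (f x y)^-1).
Proof.
move=> [f0 fE]; split=> [x y Gx Gy|x y z Gx Gy Gz].
  by rewrite invr_eq0 f0.
by rewrite -!invfM fE.
Qed.

Lemma cohomologous_cocycle2 f g :
  cocycle2 G f -> cohomologous G f g -> cocycle2 G g.
Proof.
move=> cf [u [u0 Dg]].
have [h0 hE] := cocycle2_mul cf (cocycle2_coboundary u0).
split=> [x y Gx Gy|x y z Gx Gy Gz]; first by rewrite Dg ?h0.
by rewrite !Dg ?groupM //; apply: hE.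
Qed.

Lemma cohomologous_refl f : cohomologous G f f.
Proof.
exists (fun=> 1); split=> [x _|x y _ _]; first exact: oner_neq0.
by rewrite divr1 !mulr1.
Qed.

Lemma cohomologous_sym f g : cohomologous G f g -> cohomologous G g f.
Proof.
move=> [u [u0 Dg]]; exists (fun x => (u x)^-1).
split=> [x Gx|x y Gx Gy]; first by rewrite invr_eq0 u0.
have [ux uy uxy] := And3 (u0 x Gx) (u0 y Gy) (u0 _ (groupM Gx Gy)).
by rewrite Dg //; field; rewrite ?ux ?uy ?uxy.
Qed.

Lemma cohomologous_trans f g h :
  cohomologous G f g -> cohomologous G g h -> cohomologous G f h.
Proof.
move=> [u [u0 Dg]] [v [v0 Dh]]; exists (fun x => u x * v x).
split=> [x Gx|x y Gx Gy]; first by rewrite mulf_neq0 ?u0 ?v0.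
have [ux uy uxy] := And3 (u0 x Gx) (u0 y Gy) (u0 _ (groupM Gx Gy)).
have [vx vy vxy] := And3 (v0 x Gx) (v0 y Gy) (v0 _ (groupM Gx Gy)).
by rewrite Dh // Dg //; field; rewrite ?uxy ?vxy.
Qed.

Lemma cohomologous_mulr f g h :
  cohomologous G f g ->
  cohomologous G (fun x y => f x y * h x y) (fun x y => g x y * h x y).
Proof.
move=> [u [u0 Dg]]; exists u; split=> // x y Gx Gy.
by rewrite Dg // mulrAC.
Qed.

(* For commuting [x] and [y], this is the commutator of lifts of [x] and [y] to
   the central extension defined by [f]. *)
Definition commutator_pairing f (x y : gT) : R[i] := f x y / f y x.

Local Notation beta := commutator_pairing.

Lemma commutator_pairing_neq0 f x y :
  cocycle2 G f -> x \in G -> y \in G -> beta f x y != 0.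
Proof. by move=> [f0 _] Gx Gy; rewrite mulf_neq0 ?invr_eq0 ?f0. Qed.

Lemma commutator_pairing_sym f x y : (beta f x y)^-1 = beta f y x.
Proof. by rewrite invfM invrK mulrC. Qed.

(** The cocycle identities at [(z, x, y)], [(x, z, y)] and [(x, y, z)] share their middle terms once
    [z] is moved past [x] and [y]; the rest is cancellation. *)
Lemma commutator_pairingMr f z x y :
  cocycle2 G f -> z \in G -> x \in G -> y \in G ->
  commute z x -> commute z y -> beta f z (x * y)%g = beta f z x * beta f z y.
Proof.
move=> [f0 fE] Gz Gx Gy czx czy; rewrite /commutator_pairing.
have E1 := fE _ _ _ Gz Gx Gy; have E2 := fE _ _ _ Gx Gz Gy.
have E3 := fE _ _ _ Gx Gy Gz; rewrite czx in E1; rewrite czy in E2.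
have [Gxy Gxz Gyz] := And3 (groupM Gx Gy) (groupM Gx Gz) (groupM Gy Gz).
have n1 := f0 _ _ Gx Gy; have n2 := f0 _ _ Gy Gz; have n3 := f0 _ _ Gx Gz.
have n5 := f0 _ _ Gx Gyz; have n6 := f0 _ _ Gz Gy.
have -> : f z (x * y)%g = f (x * z)%g y * f z x / f x y.
  by rewrite -E1 mulrAC mulfV ?mul1r.
have -> : f (x * y)%g z = f y z * f x (y * z)%g / f x y by rewrite E3 mulfK.
have -> : f (x * z)%g y = f z y * f x (y * z)%g / f x z by rewrite E2 mulfK.
by field; rewrite ?n1 ?n2 ?n3 ?n5.
Qed.

Lemma commutator_pairingM f g x y :
  beta (fun x y => f x y * g x y) x y = beta f x y * beta g x y.
Proof. by rewrite /commutator_pairing invfM mulrACA. Qed.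

Lemma commutator_pairingV f x y :
  beta (fun x y => (f x y)^-1) x y = (beta f x y)^-1.
Proof. by rewrite /commutator_pairing invfM. Qed.

(** A coboundary is symmetric on a commuting pair, so it cancels in the quotient. *)
Lemma commutator_pairing_cohomologous f g x y :
  cohomologous G f g -> x \in G -> y \in G -> commute x y ->
  beta g x y = beta f x y.
Proof.
move=> [u [u0 Dg]] Gx Gy cxy; rewrite /commutator_pairing !Dg // cxy.
have uxy := u0 _ (groupM Gy Gx); rewrite [u y * u x]mulrC -mulf_div mulfV ?mulr1 //.
by rewrite !mulf_neq0 ?invr_eq0 ?u0 ?groupM.
Qed.

Lemma commutator_pairing_multiplicative f z : cocycle2 G f -> z \in G ->
  {in 'C_G[z]%g &, forall x y, beta f z (x * y)%g = beta f z x * beta f z y}.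
Proof.
move=> cf Gz x y /setIP[Gx /cent1P czx] /setIP[Gy /cent1P czy].
exact: commutator_pairingMr.
Qed.

Lemma commutator_pairing_cent1_neq0 f z : cocycle2 G f -> z \in G ->
  {in 'C_G[z]%g, forall x, beta f z x != 0}.
Proof. by move=> cf Gz x /setIP[Gx _]; apply: commutator_pairing_neq0. Qed.

Lemma commutator_pairing1r f z : cocycle2 G f -> z \in G -> beta f z 1%g = 1.
Proof.
move=> cf Gz; apply: multiplicative1 (commutator_pairing_cent1_neq0 cf Gz) _.
exact: commutator_pairing_multiplicative.
Qed.

Lemma commutator_pairingXr f z x i : cocycle2 G f -> z \in G -> x \in G ->
  commute z x -> beta f z (x ^+ i)%g = beta f z x ^+ i.
Proof.
move=> cf Gz Gx czx; elim: i => [|i IHi]; first exact: commutator_pairing1r.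
rewrite expgS exprS -IHi commutator_pairingMr ?groupX //.
exact: commuteX.
Qed.

Lemma commutator_pairingXl f z x i : cocycle2 G f -> z \in G -> x \in G ->
  commute z x -> beta f (z ^+ i)%g x = beta f z x ^+ i.
Proof.
move=> cf Gz Gx czx; rewrite -commutator_pairing_sym.
by rewrite commutator_pairingXr // -exprVn commutator_pairing_sym.
Qed.

Lemma commutator_pairing_gen f z (B : {set gT}) :
  cocycle2 G f -> z \in G -> B \subset 'C_G[z]%g ->
  {in B, forall x, beta f z x = 1} -> {in <<B>>%g, forall x, beta f z x = 1}.
Proof.
move=> cf Gz; apply: multiplicative_gen (commutator_pairing_cent1_neq0 cf Gz) _ _.
exact: commutator_pairing_multiplicative.
Qed.

Lemma commutator_pairing_commg f z :
  cocycle2 G f -> z \in G ->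
  {in 'C_G[z]%g &, forall x y, beta f z [~ x, y]%g = 1}.
Proof.
move=> cf Gz; apply: multiplicative_commg (commutator_pairing_cent1_neq0 cf Gz) _.
exact: commutator_pairing_multiplicative.
Qed.

Lemma cocycle2_exp f n : cocycle2 G f -> cocycle2 G (fun x y => f x y ^+ n).
Proof.
move=> [f0 fE]; split=> [x y Gx Gy|x y z Gx Gy Gz]; first by rewrite expf_neq0 ?f0.
by rewrite -!exprMn fE.
Qed.

End Cocycles.

Local Notation beta := commutator_pairing.

(** * Inflation from a central quotient *)

(** Here [r x] is a representative of the coset of [x] and [i x] the exponent leading from it to
    [x]. These coordinates serve to define cochains one coset at a time. *)
Lemma cycle_coset_coordinates (gT : finGroupType) (z : gT) :
  exists (r : gT -> gT) (i : gT -> nat),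
  [/\ forall x, (i x < #[z]%g)%N, forall x, x = (r x * z ^+ i x)%g,
      forall x, r (x * z)%g = r x & forall x, i (x * z)%g = ((i x).+1 %% #[z]%g)%N].
Proof.
pose r x := repr (x *: <[z]>)%g.
have rz x : r (x * z)%g = r x.
  rewrite /r; congr repr; apply/lcoset_eqP.
  by rewrite mem_lcoset mulKg cycle_id.
have /choice[i iP] : forall x, exists k, (k < #[z]%g)%N /\ x = (r x * z ^+ k)%g.
  move=> x; have /lcosetP[a Za Dr] := mem_repr x (lcoset_refl <[z]> x).
  rewrite -/(r x) in Dr.
  have /cyclePmin[k lt_k Dk] : (a^-1 \in <[z]>)%g by rewrite groupV.
  by exists k; rewrite -Dk Dr mulgK.
exists r, i; split=> // x; try by have [] := iP x.
have [[_ Dx] [lti' Dxz]] := (iP x, iP (x * z)%g).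
have /eqP : (z ^+ i (x * z) = z ^+ (i x).+1)%g.
  by apply: (mulgI (r x)); rewrite -{1}rz -Dxz expgSr mulgA -Dx.
by rewrite eq_expg_mod_order => /eqP; rewrite modn_small.
Qed.

Section Inflation.

Variables (R : realType) (gT : finGroupType) (G : {group gT}).
Implicit Types (f g : gT -> gT -> R[i]) (u : gT -> R[i]).

Definition inflation (N : {set gT}) (h : coset_of N -> coset_of N -> R[i])
  (x y : gT) : R[i] := h (coset N x) (coset N y).

Lemma cohomologous_inflation (N : {group gT})
    (h h' : coset_of N -> coset_of N -> R[i]) :
  (N <| G)%g -> cohomologous (G / N)%G h h' ->
  cohomologous G (inflation h) (inflation h').
Proof.
move=> /andP[_ /fintype.subsetP nNG] [u [u0 Dh']].
exists (fun x => u (coset N x)); split=> [x Gx|x y Gx Gy].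
  by rewrite u0 ?mem_quotient.
by rewrite /inflation Dh' ?mem_quotient // morphM ?nNG.
Qed.

(** The identity at [(x, y, z)] gives invariance in the second argument, and the one at [(z, x, y)]
    in the first: each time the two factors [a] cancel. *)
Lemma cocycle2_invariant f z a :
  cocycle2 G f -> z \in 'Z(G)%g ->
  {in G, forall x, f x z = a} -> {in G, forall x, f z x = a} ->
  {in G &, forall x y i j, f (x * z ^+ i)%g (y * z ^+ j)%g = f x y}.
Proof.
move=> [f0 fE] /centerP[Gz cGz] fxz fzx.
have a0 : a != 0 by rewrite -(fxz _ Gz) f0.
have fr : {in G &, forall x y, f x (y * z)%g = f x y}.
  by move=> x y Gx Gy; apply: (mulfI a0); rewrite -{1}(fxz y) // fE // fxz ?groupM.
have fl : {in G &, forall x y, f (x * z)%g y = f x y}.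
  move=> x y Gx Gy; apply: (mulIf a0).
  by rewrite -{1}(fzx x) // -cGz // -fE // fzx ?groupM.
move=> x y Gx Gy i j; elim: i => [|i IHi].
  rewrite mulg1; elim: j => [|j IHj]; first by rewrite mulg1.
  by rewrite expgSr mulgA fr ?groupM ?groupX.
by rewrite expgSr mulgA fl ?groupM ?groupX.
Qed.

Lemma cocycle2_descend f (N : {group gT}) :
  cocycle2 G f -> (N <| G)%g ->
  {in G &, forall x y, {in N &, forall a b, f (x * a)%g (y * b)%g = f x y}} ->
  exists2 h : coset_of N -> coset_of N -> R[i],
    cocycle2 (G / N)%G h & {in G &, f =2 inflation h}.
Proof.
move=> [f0 fE] nsNG finv; have [sNG nNG] := andP nsNG.
pose h (A B : coset_of N) := f (repr A) (repr B).
have hE : {in G &, f =2 inflation h}.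
  move=> x y Gx Gy; rewrite /inflation /h.
  have reprE t : t \in G -> exists2 a, a \in N & repr (coset N t) = (t * a)%g.
    move=> Gt; have := mem_repr_coset (coset N t).
    have Nt := fintype.subsetP nNG t Gt.
    by rewrite val_coset // norm_rlcoset // => /lcosetP.
  have [a Na ->] := reprE x Gx; have [b Nb ->] := reprE y Gy.
  by rewrite finv.
exists h => //; split=> [_ _ /morphimP[x _ Gx ->] /morphimP[y _ Gy ->]|].
  by have := hE x y Gx Gy; rewrite /inflation => <-; apply: f0.
move=> _ _ _ /morphimP[x Nx Gx ->] /morphimP[y Ny Gy ->] /morphimP[z Nz Gz ->].
rewrite -!morphM //.
have hE' x1 y1 : x1 \in G -> y1 \in G -> h (coset N x1) (coset N y1) = f x1 y1.
  by move=> G1 G2; rewrite -[LHS]/(inflation h x1 y1) -hE.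
by rewrite !hE' ?groupM // fE.
Qed.

(** The coboundary of [w] makes the column at [z] constant as soon as [w (x * z)] is a constant
    multiple of [f x z * w x]. Such a [w] is built along each coset of [<[z]>] from its
    representative. *)
Lemma cohomologous_const_col f z :
  cocycle2 G f -> z \in 'Z(G)%g ->
  exists2 g, cohomologous G f g & exists a, {in G, forall x, g x z = a}.
Proof.
move=> [f0 fE] /centerP[Gz cGz].
pose q := #[z]%g; pose P n := \prod_(j < n) f (z ^+ j)%g z.
have P0 n : P n != 0 by apply/prodf_neq0 => j _; rewrite f0 ?groupX.
(* The factor [c] forces [S q = S 0], so the recursion for [w] survives the wrap-around of [i x]
   modulo [q]. *)
have [c cq] := closed_root_exists (P q)^-1 (order_gt0 z).
have c0 : c != 0.
  apply: contraTneq (P0 q) => c0; rewrite -invr_eq0 -cq c0.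
  by rewrite expr0n -leqn0 leqNgt order_gt0 eqxx.
pose S n := c ^+ n * P n.
have SS n : S n.+1 = S n * c * f (z ^+ n)%g z.
  by rewrite /S /P big_ord_recr /= exprSr; ring.
have Sq : S q = S 0%N by rewrite /S cq mulVf ?P0 // /P big_ord0 mulr1.
have S0 n : S n != 0 by rewrite mulf_neq0 ?expf_neq0.
have [r [i [lti Dx rz iz]]] := cycle_coset_coordinates z.
have Gr x : x \in G -> r x \in G.
  by rewrite {1}(Dx x) groupMr ?groupX.
pose w x := S (i x) * f (r x) (z ^+ i x)%g.
have w0 : {in G, forall x, w x != 0}.
  by move=> x Gx; rewrite mulf_neq0 ?S0 ?f0 ?Gr ?groupX.
have wz : {in G, forall x, w (x * z)%g = c * f x z * w x}.
  move=> x Gx; have Siz : S (i (x * z)%g) = S (i x).+1.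
    rewrite iz; have := lti x; rewrite leq_eqVlt => /predU1P[->|lt_i].
      by rewrite modnn Sq.
    by rewrite modn_small.
  rewrite /w rz Siz iz expg_mod_order SS.
  (* The recursion for [w] is the cocycle identity at [(r x, z ^+ i x, z)]. *)
  have E := fE _ _ _ (Gr x Gx) (groupX (i x) Gz) Gz.
  rewrite -expgSr -Dx in E.
  transitivity (S (i x) * c * (f (z ^+ i x)%g z * f (r x) (z ^+ (i x).+1)%g)).
    by ring.
  by rewrite E; ring.
exists (fun x y => f x y * coboundary w x y); first by exists w.
exists (w z / c) => x Gx; rewrite /coboundary wz //.
have fxz := f0 x z Gx Gz; have wx := w0 x Gx.
by field; rewrite ?fxz ?wx ?c0.
Qed.

(** Once the column at [z] is constant, triviality of the pairing with [z] makes the row at [z]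
    equal to the same constant; the cocycle is then invariant under [<[z]>] and descends. *)
Lemma cohomologous_to_inflation f z :
  cocycle2 G f -> z \in 'Z(G)%g -> {in G, forall x, beta f z x = 1} ->
  exists2 h : coset_of <[z]>%g -> coset_of <[z]>%g -> R[i],
    cocycle2 (G / <[z]>)%G h & cohomologous G f (inflation h).
Proof.
move=> cf Zz fz1; have /centerP[Gz cGz] := Zz.
have [g cohfg [a ga]] := cohomologous_const_col cf Zz.
have cg := cohomologous_cocycle2 cf cohfg.
have nsZ : (<[z]> <| G)%g by rewrite sub_center_normal // cycle_subG.
have ga' : {in G, forall x, g z x = a}.
  move=> x Gx; rewrite -(ga x Gx); apply/eqP; rewrite -subr_eq0.
  have := fz1 x Gx.
  rewrite -(commutator_pairing_cohomologous cohfg Gz Gx (cGz x Gx)).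
  have [g0 _] := cg; move/(canRL (mulfVK (g0 _ _ Gx Gz))) => ->.
  by rewrite mul1r subrr.
have [|h ch gh] := cocycle2_descend cg nsZ.
  move=> x y Gx Gy _ _ /cycleP[i ->] /cycleP[j ->].
  exact: (cocycle2_invariant cg Zz ga ga').
exists h => //; have [u [u0 Dg]] := cohfg; exists u; split=> // x y Gx Gy.
by rewrite -gh // Dg.
Qed.

End Inflation.

(** * Bounds on the Schur multiplier *)

Section Counting.

Variable (R : realType).

(* [|H^2(G, C^x)| <= N], phrased without forming the quotient group. *)
Definition H2_le (gT : finGroupType) (G : {group gT}) (N : nat) : Prop :=
  forall (I : finType) (F : I -> gT -> gT -> R[i]),
    (forall i, cocycle2 G (F i)) ->
    (forall i j, cohomologous G (F i) (F j) -> i = j) -> (#|I| <= N)%N.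

Variables (gT : finGroupType) (G : {group gT}).

Lemma H2_le_schur m N : (schur_multiplier R G #= `I_m)%card -> H2_le G N -> (m <= N)%N.
Proof.
move=> /card_esym /card_set_bijP[phi phi_bij] leN; rewrite -(card_ord m).
have [fun_phi inj_phi _] := phi_bij.
have /choice[F FP] : forall i : 'I_m,
    exists f, cocycle2 G f /\ cohomology_class G f = phi i.
  move=> i; have [f cf <-] : schur_multiplier R G (phi i) by apply: fun_phi => /=.
  by exists f.
apply: (leN _ F) => [i|i j cohij]; first by case: (FP i).
apply/val_inj/inj_phi; rewrite ?inE //=.
have [_ <-] := FP i; have [_ <-] := FP j; apply/seteqP; split=> g [cg cohg].
  by split=> //; apply: cohomologous_trans (cohomologous_sym cohij) cohg.
by split=> //; apply: cohomologous_trans cohij cohg.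
Qed.

Section CentralQuotient.

Variables (z : gT) (N : nat) (I : finType) (F : I -> gT -> gT -> R[i]).
Hypotheses (Zz : z \in 'Z(G)%g) (leN : H2_le (G / <[z]>)%G N).
Hypotheses (cF : forall i, cocycle2 G (F i))
  (F_inj : forall i j, cohomologous G (F i) (F j) -> i = j)
  (F1 : forall i, {in G, forall x, beta (F i) z x = 1}).

Let nsZ : (<[z]> <| G)%g.
Proof. by rewrite sub_center_normal // cycle_subG. Qed.

Lemma inflation_family :
  exists h : I -> coset_of <[z]>%g -> coset_of <[z]>%g -> R[i],
  (forall i, cocycle2 (G / <[z]>)%G (h i)) /\
  (forall i, cohomologous G (F i) (inflation (h i))).
Proof.
suff /choice[h hP] : forall i, exists h : coset_of <[z]>%g -> coset_of <[z]>%g -> R[i],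
    cocycle2 (G / <[z]>)%G h /\ cohomologous G (F i) (inflation h).
  by exists h; split=> i; case: (hP i).
by move=> i; have [h] := cohomologous_to_inflation (cF i) Zz (@F1 i); exists h.
Qed.

Lemma H2_le_inflated : (#|I| <= N)%N.
Proof.
have [h [ch hF]] := inflation_family; apply: (leN ch) => i j cohij.
apply: F_inj; apply: cohomologous_trans (hF i) _.
apply: cohomologous_trans (cohomologous_sym (hF j)).
exact: cohomologous_inflation.
Qed.

(* Twisting by the powers of a cocycle of [G / <[z]>] which becomes a coboundary
   on [G] gives [#[z]] times as many classes on [G / <[z]>]. *)
Lemma H2_le_inflated_der : (z \in G^`(1))%g -> (#|I| * #[z]%g <= N)%N.
Proof.
move=> G'z; have /centerP[Gz cGz] := Zz.
have [h [ch hF]] := inflation_family.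
have [r [k [_ _ _ kz]]] := cycle_coset_coordinates z.
have [zeta prim_zeta] := closed_prim_root_exists R[i] (order_gt0 z).
have zeta0 : zeta != 0.
  apply/eqP=> zeta0; have /eqP := prim_expr_order prim_zeta.
  by rewrite zeta0 expr0n -leqn0 leqNgt order_gt0 eq_sym oner_eq0.
(* Translation by [z] multiplies [e] by [zeta], so the coboundary of [e] is invariant under [<[z]>].
   It descends to a cocycle [T] of the quotient whose inflation is a coboundary on [G]. *)
pose e x := zeta ^+ k x.
have e0 : {in G, forall x, e x != 0} by move=> x _; rewrite expf_neq0.
have ez1 x : e (x * z)%g = zeta * e x.
  by rewrite /e kz (prim_expr_mod prim_zeta) exprS.
have ez x i : e (x * z ^+ i)%g = zeta ^+ i * e x.
  elim: i => [|i IHi]; first by rewrite mulg1 mul1r.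
  by rewrite expgSr mulgA ez1 IHi exprS mulrA.
have [|T cT De] := cocycle2_descend (cocycle2_coboundary e0) nsZ.
  move=> x y Gx Gy _ _ /cycleP[i ->] /cycleP[j ->].
  have -> : coboundary e (x * z ^+ i)%g (y * z ^+ j)%g =
      zeta ^+ i * e x * (zeta ^+ j * e y) / (zeta ^+ (i + j) * e (x * y)%g).
    rewrite /coboundary !ez; congr (_ / _); rewrite -ez expgD.
    by rewrite !mulgA -(mulgA x) -(mulgA x y) (commuteX i (esym (cGz y Gy))) ?mulgA.
  rewrite /coboundary exprD.
  have [exy zi zj] := And3 (e0 _ (groupM Gx Gy)) (expf_neq0 i zeta0) (expf_neq0 j zeta0).
  by field; rewrite ?exy ?zi ?zj.
rewrite -[#[z]%g]card_ord -card_prod.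
pose F' (ia : I * 'I_#[z]%g) A B := h ia.1 A B * T A B ^+ ia.2.
apply: (leN (F := F')) => [[i a]|[i a] [j b]] /=.
  by apply: cocycle2_mul (ch i) (cocycle2_exp _ cT).
move=> cohij.
have Dcob n : {in G &, forall x y,
    inflation T x y ^+ n = coboundary (fun x => e x ^+ n) x y}.
  by move=> x y Gx Gy; rewrite -De // /coboundary expr_div_n exprMn.
have infl_twist l c : cohomologous G (inflation (h l)) (inflation (F' (l, c))).
  exists (fun x => e x ^+ c); split=> [x Gx|x y Gx Gy]; first by rewrite expf_neq0 ?e0.
  by rewrite -[LHS]/(inflation (h l) x y * inflation T x y ^+ c) Dcob.
(* Inflation to [G] kills the twists by [T], so only the classes of [F i] and [F j] remain. *)
have Dij : i = j.
  apply: F_inj; apply: cohomologous_trans (hF i) _.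
  apply: cohomologous_trans (infl_twist i a) _.
  apply: cohomologous_trans (cohomologous_sym (hF j)).
  apply: cohomologous_trans (cohomologous_sym (infl_twist j b)).
  exact: cohomologous_inflation.
move: cohij; rewrite -{}Dij => -[u [u0 Du]].
have {}u0 : {in G, forall x, u (coset <[z]> x) != 0}.
  by move=> x Gx; rewrite u0 ?mem_quotient.
pose chi x := e x ^+ a * u (coset <[z]> x) / e x ^+ b.
have nNG := fintype.subsetP (normal_norm nsZ).
have chi0 : {in G, forall x, chi x != 0}.
  by move=> x Gx; rewrite !mulf_neq0 ?invr_eq0 ?expf_neq0 ?e0 ?u0.
have chiM : {in G &, forall x y, chi (x * y)%g = chi x * chi y}.
  move=> x y Gx Gy; have := Du _ _ (mem_quotient _ Gx) (mem_quotient _ Gy).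
  rewrite /F' /= -!/(inflation _ x y) !Dcob // -morphM ?nNG // -mulrA.
  have hxy : inflation (h i) x y != 0.
    by have [h0 _] := ch i; apply: h0; rewrite mem_quotient.
  move/(mulfI hxy); rewrite /coboundary /chi => E.
  have Gxy := groupM Gx Gy.
  have ea t : t \in G -> e t ^+ a != 0 by move=> ?; rewrite expf_neq0 ?e0.
  have eb t : t \in G -> e t ^+ b != 0 by move=> ?; rewrite expf_neq0 ?e0.
  have -> : (e (x * y)%g ^+ b)^-1 =
      e x ^+ a * e y ^+ a / e (x * y)%g ^+ a *
      (u (coset <[z]> x) * u (coset <[z]> y) / u (coset <[z]> (x * y)%g)) /
      (e x ^+ b * e y ^+ b).
    by rewrite -E; field; rewrite ?eb.
  by field; rewrite ?ea ?eb ?u0.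
have ze1 : e z = zeta * e 1%g by rewrite -ez1 mul1g.
have chi_z : chi z = chi 1%g.
  by rewrite (multiplicative_der chi0 chiM G'z) (multiplicative1 chi0 chiM).
have zeta_ab : zeta ^+ a = zeta ^+ b.
  move: chi_z; rewrite /chi ze1 coset_id ?cycle_id // morph1 !exprMn => E.
  have G1 := group1 G; have n1 := u0 _ G1; rewrite morph1 in n1.
  have n2 : e 1%g ^+ a != 0 by rewrite expf_neq0 ?e0.
  have n3 : e 1%g ^+ b != 0 by rewrite expf_neq0 ?e0.
  have n4 : zeta ^+ b != 0 by rewrite expf_neq0.
  apply: (mulIf (mulf_neq0 (mulf_neq0 n2 n1) (invr_neq0 n3))).
  apply: (mulIf (invr_neq0 n4)); rewrite [RHS]mulrAC mulfV // mul1r -[RHS]E.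
  by field; rewrite ?n3 ?n4.
congr pair; apply/val_inj/eqP; rewrite /= -(modn_small (ltn_ord a)).
by rewrite -(modn_small (ltn_ord b)) -(eq_prim_root_expr prim_zeta) zeta_ab.
Qed.

End CentralQuotient.

End Counting.

Section Steps.

Variable (R : realType).

Lemma cohomologous_eq (gT : finGroupType) (G : {group gT}) (f g : gT -> gT -> R[i]) :
  {in G &, f =2 g} -> cohomologous G f g.
Proof.
move=> Dg; have [u [u0 E]] := cohomologous_refl G f.
by exists u; split=> // x y Gx Gy; rewrite -Dg //; apply: E.
Qed.

Lemma cohomologous_divr (gT : finGroupType) (G : {group gT}) (f g h : gT -> gT -> R[i]) :
  cocycle2 G h ->
  cohomologous G (fun x y => f x y * (h x y)^-1) (fun x y => g x y * (h x y)^-1) ->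
  cohomologous G f g.
Proof.
move=> [h0 _] /(cohomologous_mulr h) cohfg.
apply: (cohomologous_trans _ (cohomologous_trans cohfg _)); apply: cohomologous_eq.
  by move=> x y Gx Gy; rewrite /= mulfVK ?h0.
by move=> x y Gx Gy; rewrite /= mulfVK ?h0.
Qed.

(** The values of [beta f z] on [s] split the classes into at most [#[z] ^ size s] parts. Dividing a
    part by one of its members makes the pairing with [z] trivial, so [H2_le_inflated_der] bounds
    each part by [N / #[z]]. *)
Lemma H2_le_central_extension (gT : finGroupType) (G : {group gT}) (z : gT)
    (s : seq gT) (N M : nat) :
  z \in 'Z(G)%g -> z \in G^`(1)%g -> {subset s <= G} ->
  (forall f : gT -> gT -> R[i], cocycle2 G f ->
     {in s, forall x, beta f z x = 1} -> {in G, forall x, beta f z x = 1}) ->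
  (#[z]%g ^ size s * N <= M * #[z]%g)%N ->
  H2_le R (G / <[z]>)%G N -> H2_le R G M.
Proof.
move=> Zz G'z sG s_det leNM leN I F cF F_inj.
have /centerP[Gz cGz] := Zz; have q_gt0 := order_gt0 z.
rewrite -(leq_pmul2r q_gt0); apply: leq_trans leNM.
have bound : (#|[set: I]| <= (\prod_(x <- s) #[z]%g) * (N %/ #[z]%g))%N.
  apply: (@card_root_family R[i] gT (fun=> #[z]%g) s I (fun i x => beta (F i) z x)).
  - by [].
  - move=> i x _ /sG Gx; rewrite -(commutator_pairingXl _ (cF i)) //; last exact: cGz.
    by rewrite expg_order -commutator_pairing_sym (commutator_pairing1r (cF i)) ?invr1.
  move=> K _ Keq; rewrite leq_divRL //.
  have [->|[i0 Ki0]] := set_0Vmem K; first by rewrite cards0.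
  rewrite -card_sig.
  pose F' (i : {i | i \in K}) x y := F (val i) x y * (F i0 x y)^-1.
  apply: (@H2_le_inflated_der R gT G z N _ F' Zz leN) => //.
  - by move=> i; apply: cocycle2_mul (cF _) (cocycle2_inv (cF i0)).
  - by move=> i j /(cohomologous_divr (cF i0))/F_inj/val_inj.
  move=> i; apply: s_det => [|x s_x].
    by apply: cocycle2_mul (cF _) (cocycle2_inv (cF i0)).
  rewrite commutator_pairingM commutator_pairingV (Keq _ i0 (valP i) Ki0 x s_x).
  by apply/mulfV/(commutator_pairing_neq0 (cF i0)) => //; apply: sG.
rewrite cardsT big_const_seq count_predT iter_muln_1 in bound.
apply: leq_trans (leq_mul bound (leqnn _)) _.
by rewrite -mulnA leq_mul2l leq_trunc_div orbT.
Qed.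

(** Induction on the order: [f] comes from a cocycle of [G / <[z]>] for any non-trivial [z], and
    that cocycle again has trivial pairing. *)
Lemma symmetric_cocycle2_coboundary n (gT : finGroupType) (G : {group gT})
    (f : gT -> gT -> R[i]) : (#|G| <= n)%N ->
  abelian G -> cocycle2 G f -> {in G &, forall x y, beta f x y = 1} ->
  cohomologous G (fun _ _ => 1) f.
Proof.
elim: n => [|n IHn] in gT G f *; first by rewrite leqNgt cardG_gt0.
move=> leGn cGG cf f1; have [G1|ntG] := eqVneq (G : {set gT}) 1%g.
  (* On the trivial group, the coboundary of a constant is that constant. *)
  have [f0 _] := cf; exists (fun=> f 1%g 1%g); split=> [x _|x y].
    by rewrite f0.
  rewrite G1 !inE => /eqP-> /eqP->; rewrite mulfK ?mul1r // f0 //.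
have /trivgPn[z Gz ntz] := ntG.
have Zz : z \in 'Z(G)%g by rewrite (center_idP cGG).
have [h ch cohfh] := cohomologous_to_inflation cf Zz (fun x Gx => f1 z x Gz Gx).
apply: cohomologous_trans (cohomologous_sym cohfh).
have nsZ : (<[z]> <| G)%g by rewrite sub_center_normal // cycle_subG.
apply: (cohomologous_inflation (h := fun _ _ => 1) nsZ).
apply: IHn => //; last 1 first.
- move=> _ _ /morphimP[x _ Gx ->] /morphimP[y _ Gy ->].
  rewrite -[LHS]/(beta (inflation h) x y).
  rewrite (commutator_pairing_cohomologous cohfh) ?f1 //.
  by apply: (centsP cGG).
- rewrite -ltnS; apply: leq_trans leGn; rewrite ltn_quotient //.
    by rewrite cycle_eq1.
  by rewrite cycle_subG.
exact: quotient_abelian.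
Qed.

Lemma abelian_cohomologous (gT : finGroupType) (G : {group gT})
    (f g : gT -> gT -> R[i]) :
  abelian G -> cocycle2 G f -> cocycle2 G g ->
  {in G &, forall x y, beta (fun x y => f x y * (g x y)^-1) x y = 1} ->
  cohomologous G f g.
Proof.
move=> cGG cf cg fg1; apply: cohomologous_sym; apply: (cohomologous_divr cg).
apply: cohomologous_trans (cohomologous_eq _)
  (symmetric_cocycle2_coboundary (leqnn _) cGG (cocycle2_mul cf (cocycle2_inv cg)) fg1).
by move=> x y Gx Gy; rewrite /= mulfV //; apply: cg.1.
Qed.

End Steps.

(** * The bound for abelian groups *)

Fixpoint ordered_pairs (T : Type) (s : seq T) : seq (T * T) :=
  if s is x :: s' then [seq (x, y) | y <- s'] ++ ordered_pairs s' else [::].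

Lemma mem_ordered_pairs (T : eqType) (s : seq T) x y :
  (x, y) \in ordered_pairs s -> x \in s /\ y \in s.
Proof.
elim: s => //= t s IHs; rewrite mem_cat !inE => /orP[/mapP[a s_a [-> ->]]|/IHs[-> ->]].
  by rewrite s_a eqxx orbT.
by rewrite !orbT.
Qed.

Lemma ordered_pairs_total (T : eqType) (s : seq T) x y :
  x \in s -> y \in s ->
  [\/ x = y, (x, y) \in ordered_pairs s | (y, x) \in ordered_pairs s].
Proof.
elim: s => //= t s IHs; rewrite !inE !mem_cat.
case/predU1P=> [->|s_x] /predU1P[->|s_y]; first by constructor 1.
- by constructor 2; rewrite map_f.
- by constructor 3; rewrite map_f.
case: (IHs s_x s_y) => [->|xy|yx]; first by constructor 1.
  by constructor 2; rewrite xy orbT.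
by constructor 3; rewrite yx orbT.
Qed.

(** Each squared minimum is at most the product of the two values, and every entry of [s] lies in
    [(size s).-1] pairs. *)
Lemma prod_minn_ordered_pairs (T : Type) (o : T -> nat) (s : seq T) :
  (forall x, 0 < o x)%N ->
  ((\prod_(xy <- ordered_pairs s) minn (o xy.1) (o xy.2)) ^ 2 <=
    (\prod_(x <- s) o x) ^ (size s).-1)%N.
Proof.
move=> o_gt0; elim: s => [|x s IHs]; first by rewrite !big_nil ?muln1 ?exp1n.
rewrite /= big_cat big_map big_cons /= expnMn expnMn.
have le_x : ((\prod_(y <- s) minn (o x) (o y)) ^ 2 <=
    o x ^ size s * \prod_(y <- s) o y)%N.
  elim: (s) => [|y t IHt]; first by rewrite !big_nil ?muln1 ?exp1n.
  rewrite !big_cons expnMn [in leqRHS]expnS.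
  have le_xy : (minn (o x) (o y) ^ 2 <= o x * o y)%N.
    by rewrite -mulnn leq_mul ?geq_minl ?geq_minr.
  apply: leq_trans (leq_mul le_xy IHt) _.
  by rewrite mulnACA.
apply: leq_trans (leq_mul le_x IHs) _; rewrite -mulnA leq_mul2l; apply/orP; right.
case: (s) => [|y t]; first by rewrite /= big_nil.
by rewrite /= -expnS.
Qed.

Lemma H2_le_abelian (R : realType) (gT : finGroupType) (G : {group gT}) :
  abelian G -> exists2 N, H2_le R G N & (N ^ 2 <= #|G| ^ ('m(G)%g).-1)%N.
Proof.
move=> cGG; have [b defG def_t] := abelian_structure cGG.
have genG : <<[set x in b]>>%g = G.
  rewrite -[RHS](bigdprodWY defG).
  elim: (b) => [|x s IHs]; first by rewrite big_nil finset.set_nil gen0.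
  by rewrite big_cons -joingE -joing_idr -IHs joing_idl joing_idr finset.set_cons.
have bG : {subset b <= G}.
  by move=> x b_x; rewrite -genG mem_gen ?inE.
have cG x y : x \in G -> y \in G -> commute x y by move=> *; apply: (centsP cGG).
exists (\prod_(xy <- ordered_pairs b) minn #[xy.1]%g #[xy.2]%g)%N; last first.
  have -> : #|G| = (\prod_(x <- b) #[x]%g)%N by rewrite (bigdprod_card defG).
  rewrite grank_abelian // -size_abelian_type // -def_t size_map.
  exact: (prod_minn_ordered_pairs (o := fun x : gT => #[x]%g)).
move=> I F cF F_inj; rewrite -cardsT -[leqRHS]muln1.
apply: (@card_root_family R[i] _ (fun xy => minn #[xy.1]%g #[xy.2]%g) _ _
   (fun i xy => beta (F i) xy.1 xy.2)).
- by move=> xy _; rewrite leq_min !order_gt0.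
(* By bimultiplicativity, the orders of both [x] and [y] kill the pairing, hence so does the smaller
   one. *)
- move=> i [x y] _ /mem_ordered_pairs[/bG Gx /bG Gy] /=.
  case: (leqP #[x]%g #[y]%g) => _.
    rewrite -(commutator_pairingXl _ (cF i)) ?expg_order //; last exact: cG.
    by rewrite -commutator_pairing_sym (commutator_pairing1r (cF i)) ?invr1.
  rewrite -(commutator_pairingXr _ (cF i)) ?expg_order //; last exact: cG.
  by rewrite (commutator_pairing1r (cF i)).
move=> K _ Keq; rewrite leqNgt; apply/negP=> /card_gt1P[i [j [Ki Kj]]].
apply/negP; rewrite negbK; apply/eqP/F_inj.
apply: abelian_cohomologous => //.
pose g x y := F i x y * (F j x y)^-1; rewrite -/g.
have cg : cocycle2 G g := cocycle2_mul (cF i) (cocycle2_inv (cF j)).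
have g_pair x y : (x, y) \in ordered_pairs b -> beta g x y = 1.
  move=> bxy; have [/bG Gx /bG Gy] := mem_ordered_pairs bxy.
  rewrite commutator_pairingM commutator_pairingV (Keq _ _ Ki Kj _ bxy) /=.
  by apply/mulfV/(commutator_pairing_neq0 (cF j)).
(* The diagonal is trivial and reversed pairs give inverses, so ordered pairs suffice; [extend] then
   passes from the basis to [G] in each variable. *)
have g_b x y : x \in b -> y \in b -> beta g x y = 1.
  move=> b_x b_y; have [-> | /g_pair // | /g_pair yx] := ordered_pairs_total b_x b_y.
    by rewrite /commutator_pairing mulfV //; apply: cg.1; apply: bG.
  by rewrite -commutator_pairing_sym yx invr1.
have extend x : x \in G ->
    {in b, forall y, beta g x y = 1} -> {in G, forall y, beta g x y = 1}.
  move=> Gx gx y; rewrite -{1}genG; apply: (commutator_pairing_gen cg) => //.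
    apply/fintype.subsetP=> t; rewrite inE => /bG Gt; rewrite inE Gt.
    by apply/cent1P; apply: cG.
  by move=> t; rewrite inE; apply: gx.
move=> x y Gx Gy; apply: (extend x) => // t b_t.
rewrite -commutator_pairing_sym (extend t (bG t b_t)) ?invr1 // => t' b_t'.
exact: g_b.
Qed.

(** * The bound for non-abelian p-groups *)

Section NonAbelian.

Variables (R : realType) (p : nat).
Hypothesis p_pr : prime p.

Lemma nonabelian_grank_gt1 (gT : finGroupType) (G : {group gT}) :
  ~~ abelian G -> (1 < 'm(G)%g)%N.
Proof.
apply: contraR; rewrite -leqNgt => leG1; have [B defG cardB] := grank_witness G.
move: leG1; rewrite -cardB -defG leq_eqVlt => /predU1P[/eqP/cards1P[x ->]|].
  exact: cycle_abelian.
by rewrite ltnS leqn0 cards_eq0 => /eqP->; rewrite gen0 abelian1.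
Qed.

Lemma der1_center_order_p (gT : finGroupType) (G : {group gT}) :
  (p.-group G)%g -> ~~ abelian G ->
  exists z, [/\ z \in 'Z(G)%g, z \in G^`(1)%g & #[z]%g = p].
Proof.
move=> pG nabG.
have ntG' : (G^`(1) != 1)%g by rewrite (sameP eqP derG1P).
have ntZ := meet_center_nil (pgroup_nil pG) (der_normal 1 G) ntG'.
have pZ : (p.-group (G^`(1) :&: 'Z(G)))%g.
  by rewrite (pgroupS _ pG) // finset.subIset ?der_sub.
have [_ p_dv _] := pgroup_pdiv pZ ntZ.
by have [z /setIP[G'z Zz] oz] := Cauchy p_pr p_dv; exists z.
Qed.

(* If [x, y] = z is central and generates [G'], then [G] is generated by [x], [y]
   and elements [c] commuting with both; by bilinearity [c] pairs trivially with
   [z], since [z] is a commutator in the centraliser of [c]. *)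
Lemma commutator_pairing_det (gT : finGroupType) (G : {group gT}) (x y : gT)
    (f : gT -> gT -> R[i]) :
  x \in G -> y \in G -> (G^`(1) = <[[~ x, y]]>)%g -> [~ x, y]%g \in 'Z(G)%g ->
  cocycle2 G f ->
  {in [:: x; y], forall t, beta f [~ x, y]%g t = 1} ->
  {in G, forall t, beta f [~ x, y]%g t = 1}.
Proof.
move=> Gx Gy defG' Zz cf fxy g Gg; set z := [~ x, y]%g in defG' Zz fxy *.
have /centerP[Gz cGz] := Zz.
have commM t a b : t \in G -> a \in G -> b \in G ->
    ([~ t, a * b] = [~ t, b] * [~ t, a])%g.
  move=> Gt Ga Gb; rewrite commgMJ; congr (_ * _)%g.
  have /cycleP[i ->] : ([~ t, a] \in <[z]>)%g by rewrite -defG' mem_commg.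
  by rewrite conjXg conjgE (cGz b Gb) mulKg.
have commX t a i : t \in G -> a \in G -> ([~ t, a ^+ i] = [~ t, a] ^+ i)%g.
  move=> Gt Ga; elim: i => [|i IHi]; first by rewrite commg1.
  by rewrite expgSr commM ?groupX // IHi expgS.
have [a Da] : exists a, ([~ x, g] = z ^+ a)%g.
  by apply/cycleP; rewrite -defG' mem_commg.
have [b Db] : exists b, ([~ y, g] = [~ y, x] ^+ b)%g.
  by apply/cycleP; rewrite -(invg_comm x y) cycleV -/z -defG' mem_commg.
(* The exponents give [t] the same commutators with [x] and [y] as [g] has, so [c] commutes with
   both. *)
pose t := (y ^+ a * x ^+ b)%g; have Gt : t \in G by rewrite groupM ?groupX.
pose c := (g * t^-1)%g; have Gc : c \in G by rewrite groupM ?groupV.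
have Dg : g = (c * t)%g by rewrite mulgKV.
have comm_c s : s \in G -> ([~ s, g] = [~ s, t])%g -> s \in 'C_G[c]%g.
  move=> Gs; rewrite Dg commM // => /(canRL (mulKg _)); rewrite mulVg => /eqP/commgP cst.
  by rewrite inE Gs; apply/cent1P.
have Cx : x \in 'C_G[c]%g.
  by apply: comm_c => //; rewrite commM ?groupX // !commX // commgg expg1n mul1g.
have Cy : y \in 'C_G[c]%g.
  by apply: comm_c => //; rewrite commM ?groupX // !commX // commgg expg1n mulg1.
have betaM := commutator_pairingMr cf Gz.
have [fx fy] : beta f z x = 1 /\ beta f z y = 1.
  by split; apply: fxy; rewrite !inE eqxx ?orbT.
rewrite Dg betaM //; try exact: cGz.
rewrite -commutator_pairing_sym (commutator_pairing_commg cf Gc Cx Cy) invr1 mul1r.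
rewrite betaM ?groupX //; try by apply/cGz/groupX.
rewrite !(commutator_pairingXr _ cf) //; try exact: cGz.
by rewrite fx fy !expr1n mulr1.
Qed.

Lemma central_quotient_card (gT : finGroupType) (G : {group gT}) (z : gT) n :
  #|G| = (p ^ n.+1)%N -> z \in 'Z(G)%g -> #[z]%g = p ->
  [/\ (<[z]> <| G)%g, #|(G / <[z]>)%g| = (p ^ n)%N
    & ('m((G / <[z]>)%G)%g.-1 <= 'm(G)%g.-1)%N].
Proof.
move=> oG Zz oz; have nsZ : (<[z]> <| G)%g by rewrite sub_center_normal // cycle_subG.
split=> //; last by rewrite -!subn1 leq_sub2r // quotient_grank ?normal_norm.
rewrite card_quotient ?normal_norm // -divgS ?normal_sub // oG -orderE oz expnS.
by rewrite mulKn ?prime_gt0.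
Qed.

Lemma noncommuting_pair (gT : finGroupType) (G : {group gT}) :
  ~~ abelian G -> exists x y, [/\ x \in G, y \in G & [~ x, y]%g != 1%g].
Proof.
move=> /fintype.subsetPn[x Gx]; rewrite -sub_cent1 => /fintype.subsetPn[y Gy ncxy].
exists x, y; split=> //; apply: contra ncxy => /commgP cxy.
exact/cent1P.
Qed.

Lemma H2_le_nonabelian (gT : finGroupType) (G : {group gT}) n k :
  (p.-group G)%g -> ~~ abelian G -> #|G| = (p ^ n)%N -> #|G^`(1)%g| = (p ^ k)%N ->
  exists2 N, H2_le R G N & (N ^ 2 <= p ^ ('m(G)%g.-1 * (n + k - 2) + 2))%N.
Proof.
elim: n => [|n IHn] in gT G k *.
  move=> _ nabG /eqP; rewrite expn0 -trivg_card1 => /eqP G1.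
  by rewrite G1 abelian1 in nabG.
move=> pG nabG oG oG'; have p_gt1 := prime_gt1 p_pr; have p_gt0 := ltnW p_gt1.
have d_gt1 := nonabelian_grank_gt1 nabG.
have [k1|k_neq1] := eqVneq k 1%N.
  rewrite {}k1 expn1 in oG' *.
  have [x [y [Gx Gy ntz]]] := noncommuting_pair nabG.
  pose z := [~ x, y]%g; have G'z : z \in G^`(1)%g by rewrite mem_commg.
  have ntG' : (G^`(1) != 1)%g by apply/trivgPn; exists z.
  have defG' : (G^`(1) = <[z]>)%g.
    apply/eqP; rewrite finset.eqEsubset cycle_subG G'z andbT.
    apply: prime_meetG; first by rewrite oG'.
    by apply/trivgPn; exists z; rewrite // inE G'z cycle_id.
  have Zz : z \in 'Z(G)%g.
    have /fintype.subsetP-> // : (G^`(1) \subset 'Z(G))%g.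
    apply: prime_meetG; first by rewrite oG'.
    exact: meet_center_nil (pgroup_nil pG) (der_normal 1 G) ntG'.
  have oz : #[z]%g = p by rewrite orderE -defG'.
  have [nsZ oGz le_d] := central_quotient_card oG Zz oz.
  have abGz : abelian (G / <[z]>)%g by rewrite sub_der1_abelian // defG'.
  have [N leN N2] := H2_le_abelian R abGz.
  exists (p * N)%N.
    apply: (H2_le_central_extension (s := [:: x; y])) leN => //.
    - by move=> t; rewrite !inE => /pred2P[]->.
    - by move=> f; apply: commutator_pairing_det.
    by rewrite oz /= expnS expn1 mulnAC.
  rewrite expnMn addnC expnD leq_mul2l; apply/orP; right.
  apply: leq_trans N2 _; rewrite oGz -expnM leq_exp2l //.
  by rewrite mulnC leq_mul //; clear; lia.
have [z [Zz G'z oz]] := der1_center_order_p pG nabG.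
have [nsZ oGz le_d] := central_quotient_card oG Zz oz.
have k_gt0 : (0 < k)%N.
  rewrite lt0n; apply: contra nabG => /eqP k0.
  by rewrite (sameP derG1P eqP) trivg_card1 oG' k0.
have sZG' : (<[z]> \subset G^`(1))%g by rewrite cycle_subG.
have nabGz : ~~ abelian (G / <[z]>)%g.
  apply: contra k_neq1 => /der1_min; rewrite normal_norm // => /(_ isT) /subset_leq_card.
  by rewrite oG' -orderE oz -[X in (_ <= X)%N]expn1 leq_exp2l // => ?; apply/eqP; lia.
have oGz' : #|((G / <[z]>)^`(1))%g| = (p ^ k.-1)%N.
  rewrite -quotient_der ?normal_norm // card_quotient; last first.
    by rewrite (fintype.subset_trans (der_sub 1 G)) ?normal_norm.
  by rewrite -divgS // oG' -orderE oz -{1}(prednK k_gt0) expnS mulKn.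
have [N leN N2] := IHn _ _ _ (quotient_pgroup _ pG) nabGz oGz oGz'.
have n_gt0 : (0 < n)%N.
  rewrite lt0n; apply: contra nabGz => /eqP n0.
  by move/eqP: oGz; rewrite n0 expn0 -trivg_card1 => /eqP->; apply: abelian1.
have [B genB cardB] := grank_witness G.
(* The values of the pairing on a minimal generating set give at most [p ^ 'm(G)] parts, and one
   factor [p] is regained. *)
exists (p ^ 'm(G)%g.-1 * N)%N.
  apply: (H2_le_central_extension (s := enum B)) leN => //.
  - by move=> t; rewrite mem_enum => Bt; rewrite -genB mem_gen.
  - move=> f cf fB; rewrite -genB; have /centerP[Gz cGz] := Zz.
    apply: (commutator_pairing_gen cf Gz) => [|t Bt]; last by rewrite fB ?mem_enum.
    apply/fintype.subsetP=> t Bt; have Gt : t \in G by rewrite -genB mem_gen.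
    by rewrite inE Gt; apply/cent1P/commute_sym/cGz.
  by rewrite oz -cardE cardB -{1}(prednK (ltnW d_gt1)) expnSr mulnAC.
rewrite expnMn -expnM; apply: leq_trans (leq_mul (leqnn _) N2) _.
rewrite -expnD leq_exp2l //.
have : ('m((G / <[z]>)%G)%g.-1 * (n + k.-1 - 2) <= 'm(G)%g.-1 * (n + k.-1 - 2))%N.
  by rewrite leq_mul.
(* No subtraction is truncated, since [n >= 1] and [k >= 2]; the extra 2 absorbs the square of
   [p ^ 'm(G).-1]. *)
have -> : (n.+1 + k - 2 = (n + k.-1 - 2) + 2)%N.
  by clear -n_gt0 k_gt0 k_neq1; lia.
by move=> le_X; rewrite mulnDr addnA leq_add2r addnC leq_add2r.
Qed.

End NonAbelian.

(** * Capability *)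

Section UniversalExtension.

Variables (R : realType) (gT : finGroupType) (G : {group gT}).

Lemma cocycle2_1r (f : gT -> gT -> R[i]) x :
  cocycle2 G f -> x \in G -> f x 1%g = f 1%g 1%g.
Proof.
move=> [f0 fE] Gx; have := fE _ _ _ Gx (group1 G) (group1 G).
by rewrite !mulg1 => /(mulIf (f0 _ _ Gx (group1 G))).
Qed.

Lemma cocycle2_1l (f : gT -> gT -> R[i]) x :
  cocycle2 G f -> x \in G -> f 1%g x = f 1%g 1%g.
Proof.
move=> [f0 fE] Gx; have := fE _ _ _ (group1 G) (group1 G) Gx.
by rewrite !mul1g => /(mulfI (f0 _ _ (group1 G) Gx)).
Qed.

Lemma cocycle2_inverse_sym (f : gT -> gT -> R[i]) x :
  cocycle2 G f -> x \in G -> f x x^-1%g = f x^-1%g x.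
Proof.
move=> cf Gx; have [f0 fE] := cf; have GVx := groupVr Gx.
have := fE _ _ _ Gx GVx Gx; rewrite mulVg mulgV cocycle2_1r // cocycle2_1l //.
by rewrite mulrC => /(mulfI (f0 _ _ (group1 G) (group1 G))).
Qed.

Let cocycle := {f : gT -> gT -> R[i] | cocycle2 G f}.

(* The extension of [G] by the group of all maps from cocycles to C^x whose
   cocycle has [f] as its component at [f]. *)
Record universal_extension := UniversalExtension {
  scalar_part : cocycle -> R[i];
  group_part : gT;
  scalar_part_neq0 : forall f, scalar_part f != 0;
  group_part_in : group_part \in G }.

Local Notation E := universal_extension.

Lemma universal_extension_eq (h h' : E) :
  (forall f, scalar_part h f = scalar_part h' f) ->
  group_part h = group_part h' -> h = h'.
Proof.
case: h h' => [a x a0 Gx] [b y b0 Gy] /= /funext eab exy.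
by subst b y; congr UniversalExtension; apply: Prop_irrelevance.
Qed.

HB.instance Definition _ := gen_eqMixin E.
HB.instance Definition _ := gen_choiceMixin E.

Let f_neq0 (f : cocycle) x y : x \in G -> y \in G -> sval f x y != 0.
Proof. by have [f0 _] := svalP f; apply: f0. Qed.

Program Definition extension_mul (h h' : E) : E :=
  @UniversalExtension
    (fun f => scalar_part h f * scalar_part h' f * sval f (group_part h) (group_part h'))
    (group_part h * group_part h')%g _ _.
Next Obligation.
by move=> h h' f; rewrite !mulf_neq0 ?scalar_part_neq0 ?f_neq0 ?group_part_in.
Qed.
Next Obligation. by move=> h h'; rewrite groupM ?group_part_in. Qed.

Program Definition extension_lift (x : gT) (Gx : x \in G) : E :=
  @UniversalExtension (fun=> 1) x _ Gx.
Next Obligation. by move=> *; apply: oner_neq0. Qed.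

(** Cocycles are not normalised, so the identity has to compensate for [f 1 1]; the same factor
    enters [extension_inv]. *)
Program Definition extension_one : E :=
  @UniversalExtension (fun f => (sval f 1%g 1%g)^-1) 1%g _ (group1 G).
Next Obligation. by move=> f; rewrite invr_neq0 ?f_neq0. Qed.

Program Definition extension_inv (h : E) : E :=
  @UniversalExtension (fun f => (scalar_part h f *
      sval f (group_part h)^-1%g (group_part h) * sval f 1%g 1%g)^-1)
    (group_part h)^-1%g _ _.
Next Obligation.
move=> h f; rewrite invr_neq0 // !mulf_neq0 ?scalar_part_neq0 ?f_neq0 ?groupV //;
  by rewrite group_part_in.
Qed.
Next Obligation. by move=> h; rewrite groupV group_part_in. Qed.

Lemma extension_mulA : associative extension_mul.
Proof.
move=> h1 h2 h3.
apply: universal_extension_eq => [[f [f0 fE]]|] /=; last by rewrite mulgA.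
have := fE _ _ _ (group_part_in h1) (group_part_in h2) (group_part_in h3).
set a := scalar_part h1 _; set b := scalar_part h2 _; set c := scalar_part h3 _.
move=> Ef; transitivity (a * b * c * (f (group_part h2) (group_part h3) *
    f (group_part h1) (group_part h2 * group_part h3)%g)); first by ring.
by rewrite Ef; ring.
Qed.

Lemma extension_1mul : left_id extension_one extension_mul.
Proof.
move=> h; apply: universal_extension_eq => [[f cf]|] /=; last by rewrite mul1g.
rewrite (cocycle2_1l cf (group_part_in h)) mulrAC mulVf ?mul1r //.
by have [f0 _] := cf; apply: f0.
Qed.

Lemma extension_mul1 : right_id extension_one extension_mul.
Proof.
move=> h; apply: universal_extension_eq => [[f cf]|] /=; last by rewrite mulg1.
rewrite (cocycle2_1r cf (group_part_in h)) mulfVK //.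
by have [f0 _] := cf; apply: f0.
Qed.

Lemma extension_Vmul : left_inverse extension_one extension_inv extension_mul.
Proof.
move=> h; apply: universal_extension_eq => [[f cf]|] /=; last by rewrite mulVg.
have n1 := scalar_part_neq0 h (exist _ f cf); have Gx := group_part_in h.
have [f0 _] := cf; have n2 := f0 _ _ (groupVr Gx) Gx.
have n3 := f0 _ _ (group1 G) (group1 G).
by field; rewrite ?n1 ?n2 ?n3.
Qed.

Lemma extension_mulV : right_inverse extension_one extension_inv extension_mul.
Proof.
move=> h; apply: universal_extension_eq => [[f cf]|] /=; last by rewrite mulgV.
have n1 := scalar_part_neq0 h (exist _ f cf); have Gx := group_part_in h.
rewrite (cocycle2_inverse_sym cf Gx).
have [f0 _] := cf; have n2 := f0 _ _ (groupVr Gx) Gx.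
have n3 := f0 _ _ (group1 G) (group1 G).
by field; rewrite ?n1 ?n2 ?n3.
Qed.

HB.instance Definition _ := isGroup.Build E extension_mulA extension_1mul
  extension_mul1 extension_Vmul extension_mulV.

Let fiber (x : gT) : set E := [set h | group_part h = x]%classic.

Lemma capable_of_commutator_pairing :
  (forall z, z \in 'Z(G)%g ->
    (forall f : gT -> gT -> R[i], cocycle2 G f -> {in G, forall x, beta f z x = 1}) ->
    z = 1%g) ->
  capable G.
Proof.
move=> epicenter1.
(* Commuting with the lifts of all [x] puts the group part in ['Z(G)] and makes its pairing trivial
   for every [f]. Conversely [f 1 y = f y 1], so elements over 1 are central. The cosets of the
   centre are therefore the fibres over [G]. *)
have centerE h : group_center E h <-> group_part h = 1%g.
  split=> [cEh|h1 k].
    have Gh := group_part_in h.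
    have comm_h x (Gx : x \in G) :
        extension_mul h (extension_lift Gx) = extension_mul (extension_lift Gx) h.
      exact: cEh.
    apply: epicenter1 => [|f cf x Gx].
      apply/centerP; split=> // x Gx.
      by have /(congr1 group_part) := comm_h x Gx.
    have /(congr1 (fun k => scalar_part k (exist _ f cf))) /= := comm_h x Gx.
    rewrite mulr1 mul1r => /(mulfI (scalar_part_neq0 _ _)) fhx.
    by rewrite /commutator_pairing fhx mulfV //; apply: cf.1.
  apply: (@universal_extension_eq (extension_mul h k) (extension_mul k h)) =>
    [[f cf]|] /=; last by rewrite h1 mulg1 mul1g.
  rewrite h1 (cocycle2_1l cf (group_part_in k)) (cocycle2_1r cf (group_part_in k)).
  by congr (_ * _); rewrite mulrC.
have partM (h k : E) : group_part (h * k)%g = (group_part h * group_part k)%g by [].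
have partV (h : E) : group_part (h^-1)%g = (group_part h)^-1%g by [].
have cosetE (h : E) :
    ([set (h * z)%g | z in group_center E] = fiber (group_part h))%classic.
  apply/seteqP; split=> [_ [z /centerE z1 <-]|k kh].
    by apply: etrans (partM h z) _; rewrite z1 mulg1.
  exists (h^-1 * k)%g; last by rewrite mulKVg.
  by apply/centerE; rewrite partM partV kh mulVg.
exists E, fiber; split.
  split=> [x Gx|x y|_ [h _ <-]].
  - by exists (extension_lift Gx) => //; rewrite cosetE.
  - rewrite !inE => Gx Gy eqxy.
    have : fiber y (extension_lift Gx) by rewrite -eqxy.
    by [].
  by exists (group_part h); rewrite ?cosetE //=; apply: group_part_in.
move=> x y Gx Gy; apply/seteqP; split=> [k kxy|_ [h hx [k ky <-]]].
  exists (extension_lift Gx) => //.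
  exists ((extension_lift Gx : E)^-1 * k)%g; last by rewrite mulKVg.
  by apply: etrans (partM _ k) _; rewrite partV kxy mulKg.
by apply: etrans (partM h k) _; rewrite hx ky.
Qed.

End UniversalExtension.

Theorem lemma2p3 (R : realType) (gT : finGroupType) (G : {group gT})
    (p n k d m : nat)
    (p_prime : prime p)
    (nonabelian : ~~ abelian G)
    (cardG : #|G| = (p ^ n)%N)
    (cardG' : #|(G^`(1))%g| = (p ^ k)%N)
    (rankG : ('m(G))%g = d)
    (cardM : (schur_multiplier R G #= `I_m)%card)
    (orderM : (m%:R = powR p%:R
       (2^-1 * (d%:R - 1) * (n%:R + k%:R - 2) + 1) :> R)%R) :
  capable G.
Proof.
have pG : (p.-group G)%g by rewrite /pgroup cardG pnatX pnat_id.
have p_gt1 := prime_gt1 p_prime; have p_gt0 := ltnW p_gt1.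
have d_gt1 : (1 < d)%N by rewrite -rankG nonabelian_grank_gt1.
have k_gt0 : (0 < k)%N.
  rewrite lt0n; apply: contra nonabelian => /eqP k0.
  by rewrite (sameP derG1P eqP) trivg_card1 cardG' k0.
have n_gt0 : (0 < n)%N.
  rewrite lt0n; apply: contra nonabelian => /eqP n0.
  by move/eqP: cardG; rewrite n0 expn0 -trivg_card1 => /eqP->; apply: abelian1.
(* Squaring removes the half from the exponent, and [n + k - 2] is not truncated because [n] and [k]
   are positive. *)
have m2 : (m ^ 2 = p ^ (d.-1 * (n + k - 2) + 2))%N.
  apply/eqP; rewrite -(eqr_nat R) !natrX orderM expr2 -powRD; last first.
    by rewrite pnatr_eq0 -lt0n p_gt0 implybT.
  rewrite -powR_mulrn ?ler0n //; apply/eqP; congr powR.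
  rewrite natrD natrM natrB ?natrD; last by lia.
  rewrite -subn1 natrB; last by lia.
  by field.
apply: (capable_of_commutator_pairing (R := R)) => z0 Zz0 z0_1.
apply/eqP; apply: contraT => ntz0.
have /centerP[Gz0 cGz0] := Zz0.
have [z [Zz oz z1]] : exists z, [/\ z \in 'Z(G)%g, #[z]%g = p &
    forall f : gT -> gT -> R[i], cocycle2 G f -> {in G, forall x, beta f z x = 1}].
  have pz0 : (p.-group <[z0]>)%g by apply: pgroupS pG; rewrite cycle_subG.
  have ntZ0 : <[z0]>%g != 1%g by rewrite cycle_eq1.
  have [_ p_dv _] := pgroup_pdiv pz0 ntZ0.
  have [_ /cycleP[i ->] oz] := Cauchy p_prime p_dv.
  exists (z0 ^+ i)%g; split=> [||f cf x Gx] //; first exact: groupX.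
  rewrite (commutator_pairingXl _ cf) //; last exact: cGz0.
  by rewrite z0_1 // expr1n.
rewrite -(prednK n_gt0) in cardG.
have [nsZ oGz] := central_quotient_card p_prime cardG Zz oz; rewrite rankG => le_d.
(* Every cocycle of [G] pairs trivially with [z], so a bound for the quotient also bounds [m]. *)
have boundM N e : H2_le R (G / <[z]>)%G N -> (N ^ 2 <= p ^ e)%N ->
    (d.-1 * (n + k - 2) + 2 <= e)%N.
  move=> leN N2; rewrite -(leq_exp2l _ _ p_gt1) -m2; apply: leq_trans N2.
  rewrite leq_exp2r //; apply: H2_le_schur cardM _ => I F cF F_inj.
  by apply: (H2_le_inflated Zz leN cF F_inj) => i; apply: z1.
(* In the abelian case the exponent [n.-1 * d.-1] is at most [d.-1 * (n + k - 2)], as [k >= 1], and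
   misses the [+ 2]. *)
have [abGz|nabGz] := boolP (abelian (G / <[z]>)%g).
  have [N leN N2] := H2_le_abelian R abGz.
  rewrite oGz -expnM in N2; have := boundM _ _ leN N2; rewrite leqNgt => /negP[].
  apply: (@leq_ltn_trans (n.-1 * d.-1)%N); first by rewrite leq_mul.
  by rewrite mulnC addn2 ltnS; apply/leqW; rewrite leq_mul //; clear -k_gt0; lia.
have n_gt1 : (0 < n.-1)%N.
  rewrite lt0n; apply: contra nabGz => /eqP n1.
  by move/eqP: oGz; rewrite n1 expn0 -trivg_card1 => /eqP->; apply: abelian1.
have /p_natP[k' oGz'] : p.-nat #|((G / <[z]>)^`(1))%g|.
  by apply: pgroupS (der_sub 1 _) (quotient_pgroup _ pG).
have le_k : (k' <= k)%N.
  rewrite -(leq_exp2l _ _ p_gt1) -oGz' -cardG' -quotient_der ?normal_norm //.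
  exact: leq_quotient.
have [N leN N2] := H2_le_nonabelian R p_prime (quotient_pgroup _ pG) nabGz oGz oGz'.
have := boundM _ _ leN N2; rewrite leqNgt => /negP[].
rewrite ltn_add2r; apply: (@leq_ltn_trans (d.-1 * (n.-1 + k - 2))%N).
  by rewrite leq_mul //; clear -le_k; lia.
(* Strictness comes from the drop from [n] to [n.-1], which counts because [d.-1] is positive;
   [n >= 2] and [k >= 1] keep [n + k - 2] positive. *)
by rewrite ltn_mul2l; clear -d_gt1 n_gt1 k_gt0; lia.
Qed.
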